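(* Let $\mathbf{k}$ be a field and let $I\subseteq\mathbf{k}[x_1,\dots,x_n]$ be a monomial ideal (with full support). Then the width of $\operatorname{suppPos}(I^P)$ is an upper bound for the projective dimension of $I$, i.e. $\operatorname{projdim}(I)\le \operatorname{width}(\operatorname{suppPos}(I^P))$.
   Context: For a monomial ideal $I$, $G(I)$ is its unique minimal set of monomial generators. The support $\operatorname{supp}(m)$ of a monomial $m$ is the set of indices of the variables dividing $m$; $\operatorname{supp}(I)=\bigcup_{m\in G(I)}\operatorname{supp}(m)$; full support means that every variable of the ring divides some element of $G(I)$ (assumed throughout the paper). Polarization: let $a_i$ be the maximum exponent with which $x_i$ appears among the elements of $G(I)$. The polarization of $x_1^{b_1}\cdots x_n^{b_n}$ (with $b_i\le a_i$) is the squarefree monomial $\prod_{i=1}^n x_{i,1}\cdots x_{i,b_i}$ in $\mathbf{k}[x_{1,1},\dots,x_{1,a_1},\dots,x_{n,1},\dots,x_{n,a_n}]$, and $I^P$ is the ideal of this ring generated by the polarizations of the elements of $G(I)$. Support poset: for a squarefree monomial ideal $L$ and each index $i\in\operatorname{supp}(L)$, let $C_i=\bigcap\{\operatorname{supp}(m): m\in G(L),\ x_i\text{ divides } m\}$. The support poset $\operatorname{suppPos}(L)$ is the set $\{C_i : i\in\operatorname{supp}(L)\}$ ordered by inclusion. The width of a finite poset is the maximum size of an antichain. *)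

(* Defs.v *)
From HB Require Import structures.
From mathcomp Require Import all_boot all_order all_algebra.
From mathcomp Require Import finmap boolp mpoly.

Set Implicit Arguments.
Unset Strict Implicit.
Unset Printing Implicit Defensive.

Import Order.TTheory GRing.Theory.
Local Open Scope ring_scope.

Definition projective (R : comNzRingType) (P : lmodType R) : Prop :=
  forall (M N : lmodType R) (f : {linear M -> N}) (g : {linear P -> N}),
    (forall y, exists x, f x = y) ->
    exists h : {linear P -> M}, forall x, f (h x) = g x.

Definition exact (R : comNzRingType) (L M N : lmodType R)
    (f : {linear L -> M}) (g : {linear M -> N}) : Prop :=
  forall x, g x = 0 <-> exists y, f y = x.

(* M has a resolution 0 -> P_d -> ... -> P_0 -> M -> 0 by projective modules;
   the resolution is indexed by nat and vanishes above degree d. *)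
Definition has_proj_resolution (R : comNzRingType) (M : lmodType R) (d : nat)
    : Prop :=
  exists (P : nat -> lmodType R) (aug : {linear P 0 -> M})
         (f : forall i, {linear P i.+1 -> P i}),
    [/\ forall i, projective (P i),
        forall i, (d < i)%N -> forall x : P i, x = 0,
        forall y, exists x, aug x = y,
        exact (f 0) aug
      & forall i, exact (f i.+1) (f i)].

(* The projective dimension of M is finite, equal to d.  The zero module gets
   projective dimension 0 with this definition. *)
Definition is_projdim (R : comNzRingType) (M : lmodType R) (d : nat) : Prop :=
  has_proj_resolution M d /\
  forall e, has_proj_resolution M e -> (d <= e)%N.

(* R^o is R as a module over itself, so its submodules are the (not
   necessarily proper) ideals of R. *)
Notation ideal R := (submodClosed R^o) (only parsing).

Definition ideal_module (R : comNzRingType) (I : ideal R) : Type :=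
  {x : R^o | x \in I}.

Section IdealModule.
Variables (R : comNzRingType) (I : ideal R).
HB.instance Definition _ := SubChoice.on (ideal_module I).
HB.instance Definition _ := [SubChoice_isSubLmodule of ideal_module I by <:].
End IdealModule.

Definition ideal_gen (R : comNzRingType) (A : R -> Prop) : {pred R^o} :=
  fun x => `[< forall J : ideal R, (forall a, A a -> a \in J) -> x \in J >].

Section IdealGen.
Variables (R : comNzRingType) (A : R -> Prop).

Fact ideal_gen_submod_closed : submod_closed (ideal_gen A).
Proof.
split=> [|a x y /asboolP xA /asboolP yA]; apply/asboolP => J AJ.
  exact: rpred0.
by rewrite rpredD ?rpredZ ?xA ?yA.
Qed.

HB.instance Definition _ :=
  GRing.isSubmodClosed.Build R R^o (ideal_gen A) ideal_gen_submod_closed.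

End IdealGen.

Definition seq_dominates (s a : seq nat) : bool := all2 leq s a.

Fact dickson_seq n (P : seq nat -> Prop) : (forall a, P a -> size a = n) ->
  exists s : seq (seq nat), (forall a, a \in s -> P a) /\
    forall a, P a -> exists2 g, g \in s & seq_dominates g a.
Proof.
elim: n P => [|n IHn] P sizeP.
  have [P0|nP0] := pselect (P [::]).
    exists [:: [::]]; split=> [a /[!inE] /eqP-> //|a /sizeP/size0nil->].
    by exists [::].
  by exists [::]; split=> // a Pa; case: nP0; rewrite -(size0nil (sizeP a Pa)).
have IHk c : exists s : seq (seq nat), (forall a, a \in s -> P a) /\
    forall t, P (c :: t) -> exists2 g, g \in s & seq_dominates g (c :: t).
  have [|s [sP s_dom]] := IHn (fun t => P (c :: t)); first by move=> t /sizeP[].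
  exists [seq c :: t | t <- s]; split=> [_ /mapP[t ts ->]|t /s_dom[g gs gt]].
    exact: sP.
  by exists (c :: g); rewrite ?map_f //= /seq_dominates /= leqnn.
have IHN N : exists s : seq (seq nat), (forall a, a \in s -> P a) /\
    forall c t, (c < N)%N -> P (c :: t) ->
      exists2 g, g \in s & seq_dominates g (c :: t).
  elim: N => [|N [s [sP s_dom]]]; first by exists [::].
  have [s' [s'P s'_dom]] := IHk N.
  exists (s ++ s'); split=> [a|c t].
    by rewrite mem_cat => /orP[/sP|/s'P].
  rewrite ltnS leq_eqVlt => /predU1P[->|ltcN] Pct.
    by have [g gs' gt] := s'_dom t Pct; exists g; rewrite // mem_cat gs' orbT.
  by have [g gs gt] := s_dom c t ltcN Pct; exists g; rewrite // mem_cat gs.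
have [|s [sP s_dom]] := IHn (fun t => exists c, P (c :: t)).
  by move=> t [c /sizeP[]].
have [N [s' [s'P s'_dom]]] : exists N (s' : seq (seq nat)),
    (forall a, a \in s' -> P a) /\
    forall t, t \in s -> exists2 c, (c <= N)%N & (c :: t) \in s'.
  elim: s sP {s_dom} => [|t s IHs] sP; first by exists 0%N, [::].
  have [u us|N [s' [s'P s'_dom]]] := IHs; first by apply: sP; rewrite inE us orbT.
  have [c Pct] := sP t (mem_head _ _).
  exists (maxn c N), ((c :: t) :: s'); split=> [a|u].
    by rewrite inE => /predU1P[->|/s'P].
  rewrite inE => /predU1P[->|/s'_dom[d ledN ds']].
    by exists c; rewrite ?leq_maxl ?mem_head.
  by exists d; rewrite ?(leq_trans ledN) ?leq_maxr // inE ds' orbT.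
have [r [rP r_dom]] := IHN N.
exists (s' ++ r); split=> [a|a Pa]; first by rewrite mem_cat => /orP[/s'P|/rP].
case: a Pa (sizeP _ Pa) => // b t Pbt _.
have [ltbN|leNb] := ltnP b N.
  by have [g gr gt] := r_dom b t ltbN Pbt; exists g; rewrite // mem_cat gr orbT.
have [g gs gt] := s_dom t (ex_intro _ b Pbt).
have [c lecN cs'] := s'_dom g gs.
exists (c :: g); first by rewrite mem_cat cs'.
by rewrite /seq_dominates /= (leq_trans lecN leNb).
Qed.

Fact dickson n (A : 'X_{1..n} -> Prop) : exists G : {fset 'X_{1..n}},
  (forall m, m \in G -> A m) /\
  forall m, A m -> exists2 g, g \in G & (g <= m)%MM.
Proof.
have [|s [sA s_dom]] := @dickson_seq n (fun a => exists2 m, A m & a = m).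
  by move=> _ [m _ ->]; rewrite size_tuple.
pose mon (a : seq nat) : 'X_{1..n} := [multinom nth 0%N a i | i < n].
have monK (m : 'X_{1..n}) : mon m = m.
  by apply/mnmP => i; rewrite mnmE (mnm_nth 0%N).
exists [fset x in [seq mon a | a <- s]]%fset; split=> [m|m Am].
  by rewrite inE => /mapP[a /sA[m' Am' ->]]; rewrite monK => ->.
have [g gs gm] := s_dom m (ex_intro2 _ _ m Am erefl).
exists (mon g); first by rewrite inE map_f.
apply/mnm_lepP => i; rewrite mnmE (mnm_nth 0%N).
move: gm; rewrite /seq_dominates all2E => /andP[/eqP sz /(all_nthP (0, 0)%N)].
move=> /(_ i); rewrite size_zip sz minnn nth_zip //; apply.
by rewrite size_tuple.
Qed.

Section MonomialIdeals.
Variables (k : fieldType) (n : nat).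

(* A monomial x_1^{m_1}...x_n^{m_n} is given by its exponent vector m. *)
Definition monomial_ideal_gen (A : 'X_{1..n} -> Prop) : ideal {mpoly k[n]} :=
  ideal_gen (fun p : {mpoly k[n]} => exists2 m, A m & p = 'X_[m]).

Definition monomials_generate (I : ideal {mpoly k[n]}) (A : 'X_{1..n} -> Prop)
    : Prop :=
  (I : {pred _}) =i monomial_ideal_gen A.

Definition monomial_ideal (I : ideal {mpoly k[n]}) : Prop :=
  exists A, monomials_generate I A.

Definition is_mingens (I : ideal {mpoly k[n]}) (G : {fset 'X_{1..n}}) : Prop :=
  monomials_generate I (fun m => m \in G) /\
  forall H : {fset 'X_{1..n}}, (H `<` G)%fset ->
    ~ monomials_generate I (fun m => m \in H).

(* G(I); the default value is never used for monomial ideals, by mingensP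
   below. *)
Definition mingens (I : ideal {mpoly k[n]}) : {fset 'X_{1..n}} :=
  if pselect (exists G, is_mingens I G) is left exG then projT1 (cid exG)
  else fset0.

Lemma mingensP (I : ideal {mpoly k[n]}) :
  monomial_ideal I -> is_mingens I (mingens I).
Proof.
move=> [A genA]; rewrite /mingens; case: pselect => [exG|[]].
  exact: projT2 (cid exG).
have [G0 [G0A G0_dom]] := dickson A.
have genG0 : monomials_generate I (fun m => m \in G0).
  move=> p; rewrite genA; apply/asboolP/asboolP => pJ J genJ; apply: pJ.
    move=> _ [m /G0_dom[g gG0 legm] ->].
    rewrite -(submK legm) mpolyXD.
    by apply: (rpredZ (V := {mpoly k[n]}^o)); apply: genJ; exists g.
  by move=> _ [m /G0A Am ->]; apply: genJ; exists m.
pose Q c := `[< exists2 G : {fset 'X_{1..n}}, #|` G|%fset = c &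
  monomials_generate I (fun m => m \in G) >].
have exQ : exists c, Q c by exists #|` G0|%fset; apply/asboolP; exists G0.
case: (ex_minnP exQ) => c /asboolP[G cG genG] minc.
exists G; split=> // H ltHG genH.
have /minc : Q #|` H|%fset by apply/asboolP; exists H.
by rewrite -cG leqNgt fproper_ltn_card.
Qed.

Definition supp (m : 'X_{1..n}) : {set 'I_n} := [set i | (0 < m i)%N].

Definition supp_ideal (I : ideal {mpoly k[n]}) : {set 'I_n} :=
  \bigcup_(m <- mingens I) supp m.

Definition full_support (I : ideal {mpoly k[n]}) : Prop :=
  supp_ideal I = [set: 'I_n].

Definition suppC (L : ideal {mpoly k[n]}) (i : 'I_n) : {set 'I_n} :=
  \bigcap_(m <- mingens L | i \in supp m) supp m.

Definition suppPos (L : ideal {mpoly k[n]}) : {set {set 'I_n}} :=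
  [set suppC L i | i in supp_ideal L].

Definition maxexp (I : ideal {mpoly k[n]}) (i : 'I_n) : nat :=
  (\max_(m <- mingens I) m i)%N.

(* The variables x_{i,j+1} of the polarized ring, with j < a_i. *)
Definition polvar (I : ideal {mpoly k[n]}) : finType :=
  {i : 'I_n & 'I_(maxexp I i)}.

(* The monomial in which x_{i,j+1} has exponent 1 if j < b_i, 0 otherwise. *)
Definition polarize (I : ideal {mpoly k[n]}) (b : 'X_{1..n})
    : 'X_{1..#|polvar I|} :=
  [multinom (let x : polvar I := enum_val v in
             nat_of_bool (tagged x < b (tag x))%N) | v < #|polvar I|].

End MonomialIdeals.

Definition polarization (k : fieldType) (n : nat) (I : ideal {mpoly k[n]})
    : ideal {mpoly k[#|polvar I|]} :=
  monomial_ideal_gen k (fun m => exists2 g, g \in mingens I & m = polarize I g).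

Definition antichain (T : finType) (le : rel T) (A : {set T}) : bool :=
  [forall x in A, forall y in A, le x y ==> (x == y)].

Definition width (T : finType) (le : rel T) (P : {set T}) : nat :=
  (\max_(A : {set T} | (A \subset P) && antichain le A) #|A|)%N.

Definition inclusion (T : finType) : rel {set T} := fun A B => A \subset B.
Arguments inclusion {T}.

(* Main.v *)
(* It suffices to resolve ideals generated by monomials x^{e(S)}, where S runs
   through a family H of subsets of the set of polarized variables and e(S)_i
   counts the elements of S lying over x_i.  By Dilworth's theorem the support
   poset is a union of w chains, so the polarized variables fall into w classes,
   and two members of H are comparable by inclusion on each class; they are also
   comparable on the fibre over each x_i.  These two conditions alone give
   pd <= w, by induction on w and |H|.  Pick S in H whose trace on the last
   class is largest, and let I' be the ideal of H' = H \ {S}.  Then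
   0 -> (I' : x^{e(S)}) -> R (+) I' -> I -> 0 is exact, and the colon ideal is
   generated by the x^{e(T \ S)}, T in H'; the sets T \ S avoid the last class
   and satisfy the same conditions, so its projective dimension is at most
   w - 1. *)

From HB Require Import structures.
Require Import Defs.
From mathcomp Require Import all_boot all_order all_algebra.
From mathcomp Require Import finmap boolp mpoly.

Set Implicit Arguments.
Unset Strict Implicit.
Unset Printing Implicit Defensive.

Import Order.TTheory GRing.Theory.

(** * Linear maps and kernels as modules *)

Section LinearOf.
Local Open Scope ring_scope.

Definition linear_of (R : comNzRingType) (M N : lmodType R) (f : M -> N)
    (lin : linear f) : {linear M -> N} :=
  HB.pack_for {linear M -> N} f (GRing.isLinear.Build R M N *:%R f lin).

End LinearOf.

Section Kernel.
Local Open Scope ring_scope.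
Variables (R : comNzRingType) (M N : lmodType R) (f : {linear M -> N}).

Definition kernel_pred : {pred M} := fun x => f x == 0.

Fact kernel_submod_closed : submod_closed kernel_pred.
Proof.
split=> [|a x y]; rewrite /kernel_pred !unfold_in ?linear0 //.
by move=> /eqP fx /eqP fy; rewrite linearP fx fy scaler0 addr0.
Qed.

HB.instance Definition _ :=
  GRing.isSubmodClosed.Build R M kernel_pred kernel_submod_closed.

Definition kernel : Type := {x : M | x \in kernel_pred}.
HB.instance Definition _ := SubChoice.on kernel.
HB.instance Definition _ := [SubChoice_isSubLmodule of kernel by <:].

Fact kernel_incl_linear : linear (val : kernel -> M).
Proof. exact: linearP. Qed.

Definition kernel_incl : {linear kernel -> M} := linear_of kernel_incl_linear.

Lemma kernelP (x : kernel) : f (kernel_incl x) = 0.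
Proof. by apply/eqP; case: x. Qed.

Lemma kernel_incl_inj : injective kernel_incl.
Proof. exact: val_inj. Qed.

Lemma kernel_exact : exact kernel_incl f.
Proof.
move=> x; split=> [/eqP fx|[y <-]]; last exact: kernelP.
by exists (exist _ x fx).
Qed.

End Kernel.

(** * Bounds on projective dimension along short exact sequences *)

Section ProjectiveDimension.
Local Open Scope ring_scope.
Variable R : comNzRingType.
Implicit Types (M N P K L A B C : lmodType R).

Definition short_exact K L A (i : {linear K -> L}) (p : {linear L -> A}) :=
  [/\ injective i, forall y, exists x, p x = y & exact i p].

Lemma kernel_short_exact M N (f : {linear M -> N}) :
  (forall y, exists x, f x = y) -> short_exact (kernel_incl f) f.
Proof. by move=> surj; split=> //; [exact: kernel_incl_inj|exact: kernel_exact]. Qed.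

(** A resolution of length at most [d], peeled off one syzygy [K] at a time, so that the
    exact-sequence arguments become inductions on [d]. *)
Fixpoint pdim_le (d : nat) M : Prop :=
  if d is e.+1 then
    exists P K (i : {linear K -> P}) (p : {linear P -> M}),
      [/\ projective P, pdim_le e K & short_exact i p]
  else projective M.

Lemma projective_regular : projective R^o.
Proof.
move=> M N f g surj; have [x fx] := surj (g 1).
have lin : linear (fun a : R^o => a *: x : M).
  by move=> a u v; rewrite scalerDl scalerA.
exists (linear_of lin) => a /=.
by rewrite linearZ /= fx -linearZ /= /GRing.scale /= mulr1.
Qed.

Lemma projective_trivial M : (forall x : M, x = 0) -> projective M.
Proof.
move=> M0 M1 N f g surj; exists \0 => x /=.
by rewrite (M0 x) !linear0.
Qed.

Lemma projective_prod M N :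
  projective M -> projective N -> projective (M * N)%type.
Proof.
move=> projM projN A B f g surj.
have linl : linear (fun x : M => g (x, 0)).
  by move=> a u v; rewrite -linearP; congr (g (_, _)); rewrite /= scaler0 addr0.
have linr : linear (fun x : N => g (0, x)).
  by move=> a u v; rewrite -linearP; congr (g (_, _)); rewrite /= scaler0 addr0.
have [hl fhl] := projM _ _ f (linear_of linl) surj.
have [hr fhr] := projN _ _ f (linear_of linr) surj.
have lin : linear (fun z : M * N => hl z.1 + hr z.2).
  by move=> a u v /=; rewrite !linearP scalerDr addrACA.
exists (linear_of lin) => -[x y] /=.
by rewrite linearD fhl fhr /= -linearD; congr (g (_, _)); rewrite /= ?addr0 ?add0r.
Qed.

Lemma projective_retract M N (s : {linear M -> N}) (r : {linear N -> M}) :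
  cancel s r -> projective N -> projective M.
Proof.
move=> sK projN A B f g surj.
have [h fh] := projN _ _ f (g \o r) surj.
by exists (h \o s) => x /=; rewrite fh /= sK.
Qed.

Lemma pdim_le_trivial d M : (forall x : M, x = 0) -> pdim_le d M.
Proof.
elim: d M => [|d IHd] M M0; first exact: projective_trivial.
(* Row vectors of length 0 serve as the zero module. *)
have Z0 (x : 'rV[R]_0) : x = 0 by exact: thinmx0.
exists 'rV[R]_0, 'rV[R]_0, idfun, \0; split; rewrite /=.
- exact: projective_trivial.
- exact: IHd.
- split=> [x y //|y|x]; first by exists 0; rewrite (M0 y).
  by split=> // _; exists x.
Qed.

Lemma pdim_le_projective d M : projective M -> pdim_le d M.
Proof.
case: d => // d projM.
have Z0 (x : 'rV[R]_0) : x = 0 by exact: thinmx0.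
exists M, 'rV[R]_0, \0, idfun; split=> //; first exact: pdim_le_trivial.
split=> [x y _|y|x]; [by rewrite (Z0 x) (Z0 y)|by exists y|].
by split=> /= [->|[y <-]] //; exists 0.
Qed.

Lemma pdim_le_iso d M N (f : {linear M -> N}) (g : {linear N -> M}) :
  cancel f g -> cancel g f -> pdim_le d M -> pdim_le d N.
Proof.
move=> fK gK; case: d => [|d] /=; first exact: projective_retract gK.
move=> [P [K [i [p [projP dK [inji surjp ex]]]]]].
exists P, K, i, (f \o p); split=> //; split=> // [y|x].
  by have [x px] := surjp (g y); exists x; rewrite /= px gK.
rewrite -ex; split=> /= [|->]; last by rewrite linear0.
by move/(congr1 g); rewrite fK linear0.
Qed.

Lemma projective_section M N (f : {linear M -> N}) :
  projective N -> (forall y, exists x, f x = y) ->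
  exists s : {linear N -> M}, cancel s f.
Proof. by move=> projN surj; have [s fs] := projN _ _ f idfun surj; exists s. Qed.

(** A section [s] of [p] splits the sequence: sending [x] to the preimage of [x - s (p x)] under
    [i], paired with [p x], makes [L] a retract of [K * A]. *)
Lemma projective_extension K L A (i : {linear K -> L}) (p : {linear L -> A}) :
  short_exact i p -> projective K -> projective A -> projective L.
Proof.
move=> [inji surjp ex] projK projA.
have [s sK] := projective_section projA surjp.
have ker x : exists y, i y = x - s (p x).
  by apply/ex; rewrite linearB sK subrr.
pose q x := projT1 (cid (ker x)).
have iq x : i (q x) = x - s (p x) by rewrite /q; case: cid.
have linq : linear q.
  move=> a u v; apply: inji.
  by rewrite (linearP i) !iq (linearP p) (linearP s) scalerBr opprD addrACA.
have lin1 : linear (fun x => (q x, p x)).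
  by move=> a u v; rewrite linq linearP.
have lin2 : linear (fun z : K * A => i z.1 + s z.2).
  by move=> a u v /=; rewrite !linearP scalerDr addrACA.
apply: (@projective_retract _ _ (linear_of lin1) (linear_of lin2)).
  by move=> x; rewrite /= iq subrK.
exact: projective_prod.
Qed.

(* Horseshoe lemma: the kernels of compatible projective covers of K, L, A
   form a short exact sequence themselves. *)
Lemma pdim_le_extension d K L A (i : {linear K -> L}) (p : {linear L -> A}) :
  short_exact i p -> pdim_le d K -> pdim_le d A -> pdim_le d L.
Proof.
elim: d K L A i p => [|d IHd] K L A i p; first exact: projective_extension.
move=> [inji surjp ex] [P [P1 [a1 [a [projP dP1 [inja1 surja exa]]]]]].
move=> [Q [Q1 [b1 [b [projQ dQ1 [injb1 surjb exb]]]]]].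
have [h ph] := projQ _ _ p b surjp.
have linc : linear (fun z : P * Q => i (a z.1) + h z.2).
  by move=> t u v /=; rewrite !linearP scalerDr addrACA.
pose c := linear_of linc.
have surjc y : exists x, c x = y.
  have [v bv] := surjb (p y).
  have /ex[k ik] : p (y - h v) = 0 by rewrite linearB ph bv subrr.
  have [u au] := surja k.
  by exists (u, v); rewrite /= au ik subrK.
exists (P * Q)%type, (kernel c), (kernel_incl c), c.
split; [exact: projective_prod| |exact: kernel_short_exact].
have pi k : p (i k) = 0 by apply/ex; exists k.
have cP1 x : c (a1 x, 0) = 0.
  by rewrite /= linear0 addr0 (exa (a1 x)).2 ?linear0 //; exists x.
have cQ x : b (val (x : kernel c)).2 = 0.
  have := kernelP x; rewrite /= => /(congr1 p).
  by rewrite linearD pi add0r ph linear0.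
pose j x : kernel c := exist _ (a1 x, 0) (introT eqP (cP1 x)).
have linj : linear j.
  by move=> t u v; apply: val_inj; rewrite /= linearP; congr pair; rewrite /= scaler0 addr0.
have exq x : exists y, b1 y = (val (x : kernel c)).2 by apply/exb.
pose q x := projT1 (cid (exq x)).
have b1q x : b1 (q x) = (val x).2 by rewrite /q; case: cid.
have linq : linear q.
  by move=> t u v; apply: injb1; rewrite linearP !b1q.
apply: (IHd _ _ _ (linear_of linj) (linear_of linq)) => //.
split=> [x y|y|x].
- by move=> /(congr1 val)[/inja1].
(* To lift [y] to the kernel of [c], the value [h (b1 y) = i k] is cancelled by a first component
   [u] with [a u = - k]. *)
- have /ex[k ik] : p (h (b1 y)) = 0 by rewrite ph; apply/exb; exists y.
  have [u au] := surja (- k).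
  have cu : c (u, b1 y) = 0 by rewrite /= au linearN ik addNr.
  by exists (exist _ (u, b1 y) (introT eqP cu)); apply: injb1; rewrite /= b1q.
split=> [qx|[y <-]]; last by apply: injb1; rewrite /= b1q linear0.
have x2 : (val x).2 = 0 by rewrite -b1q (qx : q x = 0) linear0.
have := kernelP x; rewrite /= x2 linear0 addr0 => ix.
have /exa[y ay] : a (val x).1 = 0 by apply: inji; rewrite linear0.
by exists y; apply: val_inj; apply: injective_projections; rewrite /= ?ay ?x2.
Qed.

Lemma pdim_le_prod d M N : pdim_le d M -> pdim_le d N -> pdim_le d (M * N)%type.
Proof.
have lin1 : linear (fun x : M => (x, 0) : M * N).
  by move=> a u v; congr pair; rewrite /= scaler0 addr0.
have lin2 : linear (fun z : M * N => z.2) by [].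
apply: (@pdim_le_extension _ _ _ _ (linear_of lin1) (linear_of lin2)).
split=> [x y []//|y|[x y]]; first by exists (0, y).
by split=> [/= ->|[z []]] //; exists x.
Qed.

(** For a projective [Q] mapping onto [B] with kernel [K], the kernel of the composite from [Q] to
    [C] is an extension of [A] by [K]. Both ends are bounded by [d], hence so is this syzygy of
    [C]. *)
Lemma pdim_le_quotient d A B C (i : {linear A -> B}) (p : {linear B -> C}) :
  short_exact i p -> pdim_le d A -> pdim_le d.+1 B -> pdim_le d.+1 C.
Proof.
move=> [inji surjp ex] dA [Q [K [a [b [projQ dK [inja surjb exb]]]]]].
pose c : {linear Q -> C} := p \o b.
exists Q, (kernel c), (kernel_incl c), c; split=> //; last first.
  apply: kernel_short_exact => y; have [z <-] := surjp y.
  by have [x <-] := surjb z; exists x.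
have cK x : c (a x) = 0.
  by rewrite /= (exb (a x)).2 ?linear0 //; exists x.
pose j x : kernel c := exist _ (a x) (introT eqP (cK x)).
have linj : linear j by move=> t u v; apply: val_inj; rewrite /= linearP.
have exq x : exists y, i y = b (val (x : kernel c)).
  by apply/ex; exact: (kernelP x).
pose q x := projT1 (cid (exq x)).
have iq x : i (q x) = b (val x) by rewrite /q; case: cid.
have linq : linear q by move=> t u v; apply: inji; rewrite linearP !iq /= linearP.
apply: (pdim_le_extension (i := linear_of linj) (p := linear_of linq)) => //.
split=> [x y /(congr1 val)/inja//|y|x].
  have [x bx] := surjb (i y).
  have cx : c x = 0 by rewrite /= bx; apply/ex; exists y.
  by exists (exist _ x (introT eqP cx)); apply: inji; rewrite /= iq.
split=> [/= qx|[y <-]].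
  have /exb[y ay] : b (val x) = 0 by rewrite -iq qx linear0.
  by exists y; apply: val_inj.
by apply: inji; rewrite /= iq linear0 /=; apply/exb; exists y.
Qed.

Lemma pdim_le_resolution d M : pdim_le d M -> has_proj_resolution M d.
Proof.
elim: d M => [|d IHd] M.
  move=> projM; have Z0 (x : 'rV[R]_0) : x = 0 by exact: thinmx0.
  exists (fun i => if i is _.+1 then 'rV[R]_0 else M), idfun.
  exists (fun i => \0); split=> [[|i]|[|i]|y|x|i x] //.
  - exact: projective_trivial.
  - by exists y.
  - by split=> /= [->|[y <-]] //; exists 0.
  - by split=> // _; exists 0; rewrite (Z0 x).
move=> [P [K [i [p [projP /IHd[Q [aug [f [projQ Q0 surj ex0 ex]]]] [inji surjp exip]]]]]].
(* The resolution of [K] is shifted up by one degree and spliced to [P] through [i \o aug]. *)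
pose PQ j := if j is j'.+1 then Q j' else P.
pose fQ j : {linear PQ j.+1 -> PQ j} :=
  if j is j'.+1 return {linear PQ j.+1 -> PQ j} then f j' else i \o aug.
exists PQ, p, fQ; split=> [[|j]|[|j]|y|x|[|j] x] //=.
- exact: Q0.
- rewrite exip; split=> [[y <-]|[z <-]]; last by exists (aug z).
  by have [z <-] := surj y; exists z.
- rewrite -ex0; split=> [|->]; last exact: linear0.
  by move=> iax; apply: inji; rewrite linear0.
- exact: ex.
Qed.

Lemma pdim_le_is_projdim d M :
  pdim_le d M -> exists2 e, is_projdim M e & (e <= d)%N.
Proof.
move=> /pdim_le_resolution resd.
have ex : exists e, `[< has_proj_resolution M e >] by exists d; apply/asboolP.
case: (ex_minnP ex) => e /asboolP rese mine.
exists e; last by apply: mine; apply/asboolP.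
by split=> // e' rese'; apply: mine; apply/asboolP.
Qed.

End ProjectiveDimension.

(** * Dilworth's theorem, with chains given as colour classes *)

Section Dilworth.
Variables (T : finType) (le : rel T).
Hypotheses (le_refl : reflexive le) (le_anti : antisymmetric le).
Hypothesis le_trans : transitive le.
Implicit Types (A P Q : {set T}).

Lemma antichainP A :
  reflect {in A &, forall x y, le x y -> x = y} (antichain le A).
Proof.
apply: (iffP forallP) => [anti x y Ax Ay lexy|anti x].
  by have /implyP/(_ Ax)/forallP/(_ y) := anti x; rewrite Ay lexy => /eqP.
apply/implyP => Ax; apply/forallP => y; apply/implyP => Ay.
by apply/implyP => /(anti _ _ Ax Ay)/eqP.
Qed.

Lemma leq_width A P : A \subset P -> antichain le A -> #|A| <= width le P.
Proof.
move=> AP anti.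
by apply: (@leq_bigmax_cond _ _ (fun A : {set T} => #|A|) A); rewrite AP.
Qed.

Lemma width_attained P : exists A,
  [/\ A \subset P, antichain le A & #|A| = width le P].
Proof.
have [|A /andP[AP anti] widthA] :=
    @eq_bigmax_cond _ (fun A => (A \subset P) && antichain le A) (fun A => #|A|).
  apply/card_gt0P; exists set0; rewrite unfold_in sub0set.
  by apply/antichainP => x y; rewrite inE.
by exists A.
Qed.

Lemma exists_maximal P x0 : x0 \in P ->
  exists2 a, a \in P & {in P, forall y, le a y -> y = a}.
Proof.
(* An element with the most elements of [P] below it is maximal: anything above it has at least the
   same down-set. *)
move=> Px0; pose f a := #|[set y in P | le y a]|.
have [a Pa maxa] : exists2 a, a \in P & forall y, y \in P -> f y <= f a.
  by case: (@arg_maxnP _ x0 (mem P) f Px0) => a; exists a.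
exists a => // y Py leay; apply: le_anti; rewrite leay andbT.
have /eqP : [set z in P | le z a] == [set z in P | le z y].
  rewrite eqEcard maxa // andbT; apply/subsetP => z.
  by rewrite !inE => /andP[-> /le_trans->].
by move/setP/(_ y); rewrite !inE Py le_refl /= => ->.
Qed.

Definition chain_coloring P (c : T -> nat) :=
  {in P &, forall x y, c x = c y -> le x y || le y x}.

(* Galvin's proof: remove a maximal element a, cover the rest by k chains, and
   let x i be the top of the i-th chain among elements of k-element antichains.
   The x i form an antichain; if a lies above some x i, then a together with
   the part of that chain below x i is a chain whose removal lowers the
   width. *)
Lemma dilworth P : exists2 c : T -> nat,
  {in P, forall x, c x < width le P} & chain_coloring P c.
Proof.
have [m] := ubnP #|P|; elim: m P => // m IHm P ltPm.
have [->|[x0 Px0]] := set_0Vmem P.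
  by exists (fun => 0) => [x|x y]; rewrite inE.
have [a Pa maxa] := exists_maximal Px0.
have cardP : #|P :\ a| < #|P| by rewrite [ltnRHS](cardsD1 a) Pa.
have [c ltc chc] := IHm _ (leq_trans cardP ltPm).
set k := width le (P :\ a) in ltc.
pose maxanti A := [&& A \subset P :\ a, antichain le A & #|A| == k].
(* Elements of an antichain have distinct colours, so [k] of them use up all [k] colours. *)
have meets A i : i < k -> maxanti A -> exists2 x, x \in A & c x = i.
  move=> ltik /and3P[/subsetP AP /antichainP anti /eqP cardA].
  (* Since [k] may be 0, [inord] needs the larger type ['I_k.+1]; the image of [A] then misses
     exactly [ord_max]. *)
  pose j (x : T) : 'I_k.+1 := inord (c x).
  have jE x : x \in A -> j x = c x :> nat.
    by move=> Ax; rewrite inordK // ltnS ltnW // ltc ?AP.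
  have injj : {in A &, injective j}.
    move=> x y Ax Ay eqj; have eqc : c x = c y by rewrite -!jE ?eqj.
    have /orP[/anti->//|/anti->//] := chc _ _ (AP x Ax) (AP y Ay) eqc.
  suff /imsetP[x Ax jx] : (inord i : 'I_k.+1) \in j @: A.
    by exists x => //; rewrite -jE // -jx inordK // ltnS ltnW.
  suff -> : j @: A = [set~ ord_max].
    by rewrite !inE -val_eqE /= inordK ?ltn_eqF // ltnS ltnW.
  apply/eqP; rewrite eqEcard cardsC1 card_ord card_in_imset // cardA leqnn andbT.
  apply/subsetP => _ /imsetP[x Ax ->].
  by rewrite !inE -val_eqE /= jE // ltn_eqF // ltc ?AP.
have [A0 A0max] : exists A, maxanti A.
  have [A [AP anti cardA]] := width_attained (P :\ a).
  by exists A; rewrite /maxanti AP anti cardA eqxx.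
pose D i := [set x in P :\ a | (c x == i) && [exists A, maxanti A && (x \in A)]].
(* The bound on [i] sits under the existential so that [choice] yields a total function; [a] is a
   dummy value for [i >= k]. As [D i] lies in one chain, its maximal element is its greatest. *)
have exD i : exists x, i < k -> x \in D i /\ {in D i, forall y, le y x}.
  have [ltik|] := boolP (i < k); last by exists a.
  have [x Ax cx] := meets _ i ltik A0max.
  have Dx : x \in D i.
    rewrite inE cx eqxx (subsetP (proj1 (andP A0max))) //.
    by apply/existsP; exists A0; rewrite A0max.
  have [y Dy maxy] := exists_maximal Dx; exists y => _; split=> // z Dz.
  move: (Dy) (Dz); rewrite !(inE, negb_and).
  move=> /andP[Py /andP[/eqP cy _]] /andP[Pz /andP[/eqP cz _]].
  have /orP[/maxy->//|//] : le y z || le z y by apply: chc; rewrite ?inE ?cy ?cz.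
have [x xD] := choice exD.
have xP i : i < k -> x i \in P :\ a.
  by move=> /xD[]; rewrite inE => /andP[].
have cx i : i < k -> c (x i) = i.
  by move=> /xD[]; rewrite inE => /andP[_ /andP[/eqP]].
(* A maximum antichain through [x j] has a member [y] of colour [i], and [y] lies below [x i]. If
   [x i] is below [x j], then [y = x j] and the colours agree. *)
have xanti i j : i < k -> j < k -> le (x i) (x j) -> i = j.
  move=> ltik ltjk leij.
  have := (xD j ltjk).1; rewrite inE => /andP[_ /andP[_ /existsP[A /andP[Amax Axj]]]].
  have [y Ay cy] := meets _ i ltik Amax.
  have /and3P[/subsetP AP /antichainP anti /eqP cardA] := Amax.
  have leyi : le y (x i).
    apply: (xD i ltik).2; rewrite inE cy eqxx AP //.
    by apply/existsP; exists A; rewrite Amax.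
  have eqy : y = x j by apply: anti => //; apply: le_trans leij.
  by rewrite -cy -(cx j) // -eqy.
have leqPa : k <= width le P.
  have [A [AP anti]] := width_attained (P :\ a); rewrite -/k => <-.
  by rewrite leq_width // (subset_trans AP) ?subD1set.
have [i leia|incomp] := pickP (fun i : 'I_k => le (x i) a); last first.
  (* With no [x i] below [a], adding [a] to the [x i] gives an antichain of size [k.+1], so the
     colour [k] is available for [a] alone. *)
  have ltk : k < width le P.
    pose X := a |: [set x i | i : 'I_k].
    have <- : #|X| = k.+1.
      rewrite cardsU1 card_imset ?card_ord; last first.
        by move=> i j eqx; apply/val_inj/(xanti _ _ (ltn_ord i) (ltn_ord j));
          rewrite eqx le_refl.
      case: imsetP => // -[i _ eqa].
      by have := xP i (ltn_ord i); rewrite -eqa !inE eqxx.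
    apply: leq_width.
      apply/subsetP => y; rewrite !inE => /predU1P[->//|/imsetP[i _ ->]].
      by have := xP i (ltn_ord i); rewrite inE => /andP[].
    apply/antichainP => y z; rewrite !inE.
    move=> /predU1P[->|/imsetP[i _ ->]] /predU1P[->|/imsetP[j _ ->]] //.
    - have := xP j (ltn_ord j); rewrite inE => /andP[_ Pj] /(maxa _ Pj)->//.
    - by rewrite incomp.
    - by move=> /(xanti _ _ (ltn_ord i) (ltn_ord j))->.
  exists (fun y => if y == a then k else c y) => [y Py|y z Py Pz].
    by case: eqP => // /eqP nya; rewrite (leq_trans (ltc _ _)) // !inE nya.
  case: eqP => [->|/eqP nya]; case: eqP => [->|/eqP nza]; rewrite ?le_refl //.
  - by move=> kE; have := ltc z; rewrite !inE nza Pz -kE ltnn => /(_ isT).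
  - by move=> kE; have := ltc y; rewrite !inE nya Py kE ltnn => /(_ isT).
  - by apply: chc; rewrite !inE ?nya ?nza.
(* Otherwise [K], consisting of [a] and the part of chain [i] below [x i], is a chain and can be
   given one colour. *)
pose K := a |: [set z in P :\ a | (c z == i) && le z (x i)].
have Ka : a \in K by rewrite !inE eqxx.
have ltPK : #|P :\: K| < m.
  apply: leq_ltn_trans (leq_trans cardP _); last by rewrite -ltnS.
  by apply/subset_leq_card/setDS; rewrite sub1set.
(* A [k]-element antichain avoiding [K] would meet chain [i] in an element of [D i]; this is below
   [x i], hence in [K]. *)
have ltw : width le (P :\: K) < k.
  have [A [AP anti cardA]] := width_attained (P :\: K).
  have AP1 : A \subset P :\ a.
    by apply: subset_trans AP _; apply: setDS; rewrite sub1set.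
  rewrite -cardA ltn_neqAle leq_width // andbT; apply/negP => cardk.
  have Amax : maxanti A by rewrite /maxanti AP1 anti.
  have [y Ay cy] := meets _ i (ltn_ord i) Amax.
  have := subsetP AP y Ay; rewrite inE => /andP[/negP[]].
  rewrite inE [in X in _ || X]inE (subsetP AP1) // cy eqxx.
  rewrite (xD i (ltn_ord i)).2 ?orbT // inE cy eqxx (subsetP AP1) //.
  by apply/existsP; exists A; rewrite Amax.
have [c' ltc' chc'] := IHm _ ltPK.
have chK : {in K &, forall y z, le y z || le z y}.
  move=> y z; rewrite !inE.
  move=> /predU1P[->|/andP[/andP[nya Py] /andP[/eqP cy leyx]]];
    move=> /predU1P[->|/andP[/andP[nza Pz] /andP[/eqP cz lezx]]].
  - by rewrite le_refl.
  - by rewrite (le_trans lezx leia) orbT.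
  - by rewrite (le_trans leyx leia).
  - by apply: chc; rewrite ?inE ?nya ?nza // cy cz.
have kgt0 : 0 < k := leq_ltn_trans (leq0n _) ltw.
have notK u : u \in P -> u \notin K -> c' u < k.-1.
  move=> Pu nKu; have ltu : c' u < width le (P :\: K) by rewrite ltc' // inE nKu.
  by apply: leq_trans ltu _; rewrite -ltnS prednK.
(* The remainder uses only colours below [k.-1], which leaves [k.-1] for [K]. *)
exists (fun y => if y \in K then k.-1 else c' y) => [y Py|y z Py Pz].
  case: ifPn => [_|nKy]; first by rewrite prednK.
  by rewrite (leq_trans (notK _ Py nKy)) // (leq_trans (leq_pred _)).
case: ifPn => Ky; case: ifPn => Kz.
- by move=> _; apply: chK.
- by move=> kE; have := notK _ Pz Kz; rewrite -kE ltnn.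
- by move=> kE; have := notK _ Py Ky; rewrite kE ltnn.
- by apply: chc'; rewrite inE ?Ky ?Kz.
Qed.

End Dilworth.

(** * Ideals as modules, and adding one generator *)

Section IdealModules.
Local Open Scope ring_scope.
Variable R : comNzRingType.
Implicit Types I J : ideal R.

Lemma ideal_val_linear I : linear (val : ideal_module I -> R^o).
Proof. exact: linearP. Qed.

(** Ideals with the same elements may still be carried by different predicates, hence have different
    module types; this transports bounds between them. *)
Lemma pdim_le_ideal_eq d I J : (I : {pred _}) =i J ->
  pdim_le d (ideal_module I) -> pdim_le d (ideal_module J).
Proof.
move=> eqIJ; have memJ (x : ideal_module I) : val x \in J by rewrite -eqIJ (valP x).
have memI (x : ideal_module J) : val x \in I by rewrite eqIJ (valP x).
pose f x : ideal_module J := exist _ (val x) (memJ x).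
pose g x : ideal_module I := exist _ (val x) (memI x).
have linf : linear f by move=> a u v; apply: val_inj; exact: ideal_val_linear.
have ling : linear g by move=> a u v; apply: val_inj; exact: ideal_val_linear.
by apply: (@pdim_le_iso _ _ _ _ (linear_of linf) (linear_of ling)) => x; apply: val_inj.
Qed.

Lemma ideal_mull I (a x : R) : x \in I -> a * x \in I.
Proof. exact: (@rpredZ R R^o I a x). Qed.

Lemma ideal_opp I (x : R) : (- x \in I) = (x \in I).
Proof.
by apply/idP/idP => /(ideal_mull (-1)); rewrite mulN1r ?opprK.
Qed.

Lemma projective_unit_ideal I : 1 \in I -> projective (ideal_module I).
Proof.
move=> I1; have memI (x : R^o) : x \in I.
  by rewrite -[x]mulr1 ideal_mull.
pose f (x : ideal_module I) : R^o := val x.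
pose g (x : R^o) : ideal_module I := exist _ x (memI x).
have linf : linear f := @ideal_val_linear I.
have ling : linear g by move=> a u v; apply: val_inj.
apply: (@projective_retract _ _ _ (linear_of linf) (linear_of ling)) => [x|].
  exact: val_inj.
exact: projective_regular.
Qed.

(** Here [J] is the colon ideal of [I] by [g], and [K] is generated by [g] and [I]. In the exact
    sequence from [J] through [R^o * ideal_module I] to [K], the maps send [q] to [(q, - (q * g))]
    and [(a, b)] to [a * g + b]. *)
Lemma pdim_le_cons_ideal d (g : R) (I J K : ideal R) :
    (forall q, (q \in J) = (q * g \in I)) ->
    (forall p, p \in K <-> exists a b, b \in I /\ p = a * g + b) ->
  pdim_le d (ideal_module J) -> pdim_le d.+1 (ideal_module I) ->
  pdim_le d.+1 (ideal_module K).
Proof.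
move=> colon memK dJ dI.
have memI (q : ideal_module J) : - (val q * g) \in I.
  by rewrite ideal_opp -colon (valP q).
have memKI (z : R^o * ideal_module I) : z.1 * g + val z.2 \in K.
  by apply/memK; exists z.1, (val z.2); split=> //; apply: valP.
pose i (q : ideal_module J) : R^o * ideal_module I :=
  (val q, exist _ (- (val q * g)) (memI q)).
pose p (z : R^o * ideal_module I) : ideal_module K :=
  exist _ (z.1 * g + val z.2) (memKI z).
have lini : linear i.
  move=> a u v; congr pair; apply: val_inj => /=.
  by rewrite /GRing.scale /= mulrDl opprD mulrN mulrA.
have linp : linear p.
  move=> a u v; apply: val_inj; rewrite /= mulrDl scalerDr.
  by rewrite addrACA /GRing.scale /= mulrA.
apply: (pdim_le_quotient (i := linear_of lini) (p := linear_of linp)) => //.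
  split=> [x y /(congr1 fst)|[y Ky]|[a b]]; first exact: val_inj.
    have /memK[a [b [Ib yE]]] := Ky.
    by exists (a, exist _ b Ib); apply: val_inj.
  split=> [/(congr1 val)/= ab0|[q [<- <-]]]; last first.
    by apply: val_inj; rewrite /= subrr.
  have bE : val b = - (a * g) by apply/eqP; rewrite -addr_eq0 addrC ab0.
  have Ja : a \in J by rewrite colon -ideal_opp -bE (valP b).
  by exists (exist _ a Ja); congr pair; apply: val_inj.
apply: pdim_le_prod => //; apply: pdim_le_projective.
exact: projective_regular.
Qed.

End IdealModules.

(** * Monomial ideals, with membership tested on the support *)

Section MonomialSpan.
Local Open Scope ring_scope.
Variables (k : fieldType) (n : nat).
Implicit Types (s : seq 'X_{1..n}) (m g h : 'X_{1..n}) (p q : {mpoly k[n]}).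

Definition divisible_by s m := has (fun g => (g <= m)%MM) s.

Lemma divisible_byD s m h : divisible_by s m -> divisible_by s (h + m)%MM.
Proof.
move=> /hasP[g sg legm]; apply/hasP; exists g => //.
by apply: lepm_trans legm _; apply: lem_addl.
Qed.

(** The ideal generated by the monomials in [s], in boolean form: a polynomial belongs to it exactly
    when each of its terms does. *)
Definition mon_span s : {pred {mpoly k[n]}^o} :=
  fun p : {mpoly k[n]} => all (divisible_by s) (msupp p).

Lemma mon_spanP s p :
  reflect {in msupp p, forall m, divisible_by s m} (p \in mon_span s).
Proof. exact: allP. Qed.

Fact mon_span_submod_closed s : submod_closed (mon_span s).
Proof.
split=> [|a p q /mon_spanP sp /mon_spanP sq]; first by rewrite unfold_in -mpolyC0 msupp0.
apply/mon_spanP => m /msuppD_le; rewrite mem_cat => /orP[|/sq//].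
by move=> /msuppM_le/allpairsP[[m1 m2] [_ /sp m2s ->]]; apply: divisible_byD.
Qed.

HB.instance Definition _ s :=
  GRing.isSubmodClosed.Build _ _ (mon_span s) (mon_span_submod_closed s).

Lemma mem_mon_spanX s m : ('X_[m] \in mon_span s) = divisible_by s m.
Proof. by rewrite unfold_in msuppX /= andbT. Qed.

Lemma mem_mon_spanZX s m (c : k) :
  divisible_by s m -> c *: 'X_[m] \in mon_span s.
Proof.
move=> sm; rewrite -mul_mpolyC.
by rewrite ideal_mull ?mem_mon_spanX.
Qed.

Lemma mem_mon_spanMX s g q :
  (q * 'X_[g] \in mon_span s) = all (fun m => divisible_by s (g + m)%MM) (msupp q).
Proof. by rewrite unfold_in (perm_all _ (msuppMX q g)) all_map. Qed.

Lemma eq_mon_span s t :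
  (forall m, divisible_by s m = divisible_by t m) -> mon_span s =i mon_span t.
Proof. by move=> st p; rewrite !unfold_in; apply: eq_all. Qed.

(** The terms of [p] are sorted one by one: multiples of ['X_[g]] go into [a], the others into
    [b]. *)
Lemma mem_mon_span_cons g s p :
  p \in mon_span (g :: s) <-> exists a b, b \in mon_span s /\ p = a * 'X_[g] + b.
Proof.
split=> [/mon_spanP sp|[a [b [sb ->]]]]; last first.
  apply/mon_spanP => m /msuppD_le; rewrite mem_cat => /orP[|/(mon_spanP _ _ sb)].
    rewrite (perm_mem (msuppMX a g)) => /mapP[h _ ->].
    by rewrite /divisible_by /= lem_addr.
  by rewrite /divisible_by /= => ->; rewrite orbT.
rewrite [p]mpolyE big_seq; elim/big_ind: _ => [||m mp].
- by exists 0, 0; rewrite rpred0 mul0r addr0.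
- move=> _ _ [a [b [sb ->]]] [a' [b' [sb' ->]]]; exists (a + a'), (b + b').
  by rewrite rpredD // mulrDl addrACA.
have /orP[legm|sm] := sp m mp.
  exists (p@_m *: 'X_[m - g]), 0.
  by rewrite rpred0 addr0 -scalerAl -mpolyXD submK.
by exists 0, (p@_m *: 'X_[m]); rewrite mul0r add0r mem_mon_spanZX.
Qed.

Lemma monomial_ideal_genE (A : 'X_{1..n} -> Prop) s :
  (forall m, A m <-> m \in s) -> monomial_ideal_gen k A =i mon_span s.
Proof.
move=> As p; apply/asboolP/mon_spanP => [pA|sp J AJ].
  apply/mon_spanP/pA => _ [m /As sm ->]; rewrite mem_mon_spanX.
  by apply/hasP; exists m => //; apply: lepm_refl.
rewrite [p]mpolyE big_seq; apply: rpred_sum => m /sp /hasP[g /As Ag legm].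
rewrite -(submK legm) mpolyXD scalerAl.
by apply: ideal_mull; apply: AJ; exists g.
Qed.

Lemma monomials_generateE (I : ideal {mpoly k[n]}) (A : 'X_{1..n} -> Prop) s :
  (forall m, A m <-> m \in s) ->
  monomials_generate I A <-> (I : {pred _}) =i mon_span s.
Proof.
move=> As; have AE := monomial_ideal_genE As.
by split=> IA p; rewrite IA AE.
Qed.

End MonomialSpan.

Arguments mon_span k {n} s _.

(** * Resolving ideals of families of sets with nested traces *)

Section Nested.
Local Open Scope ring_scope.
Variables (k : fieldType) (n : nat) (T : finType) (lab : T -> 'I_n).
Implicit Types (S D : {set T}) (H : seq {set T}).

(** The exponent vector written e(S) in the overview; [lab] sends a polarized variable to the index
    of the variable it lies over. *)
Definition label_count S : 'X_{1..n} := [multinom #|S :&: [set v | lab v == i]| | i < n].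

Definition nested H D :=
  {in H &, forall S S', (S :&: D \subset S') || (S' :&: D \subset S)}.

Lemma nestedS H H' D : {subset H' <= H} -> nested H D -> nested H' D.
Proof. by move=> sub nest S S' /sub HS /sub HS'; apply: nest. Qed.

Lemma nestedD H D S : nested H D -> nested [seq S' :\: S | S' <- H] D.
Proof.
move=> nest _ _ /mapP[A HA ->] /mapP[B HB ->].
have sub (A' B' : {set T}) : A' :&: D \subset B' -> (A' :\: S) :&: D \subset B' :\: S.
  by move=> sAB; rewrite setIDAC setSD.
by have /orP[/sub->//|/sub->] := nest A B HA HB; rewrite ?orbT.
Qed.

(** The traces on [D] are totally ordered by inclusion, so one of largest cardinality contains all
    the others. *)
Lemma nested_max H D S0 : nested H D -> S0 \in H ->
  exists2 S, S \in H & {in H, forall S', S' :&: D \subset S}.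
Proof.
move=> nest HS0.
case: (@arg_maxnP _ S0 (mem H) (fun S => #|S :&: D|) HS0) => S HS maxS.
exists S => // S' HS'; have /orP[//|sub] := nest S' S HS' HS.
have /eqP <- : S :&: D == S' :&: D.
  by rewrite eqEcard subsetI sub subsetIr /=; apply: maxS.
exact: subsetIl.
Qed.

(** On each fibre one trace contains the other, so either the cardinalities subtract or both sides
    are 0 by truncation. *)
Lemma label_countD S S' : (forall i, nested [:: S; S'] [set v | lab v == i]) ->
  label_count (S' :\: S) = (label_count S' - label_count S)%MM.
Proof.
move=> nest; apply/mnmP => i; rewrite mnmBE !mnmE setIDAC.
set F := [set v | _].
have -> : S' :&: F :\: S = (S' :&: F) :\: (S :&: F).
  apply/setP => v; rewrite !inE; case: (lab v == i); rewrite ?andbT //.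
  by rewrite !andbF.
rewrite cardsD; have /orP[sub|sub] := nest i S S' (mem_head _ _) (mem_last S [:: S']).
  have {}sub : S :&: F \subset S' :&: F by rewrite subsetI sub subsetIr.
  by rewrite (setIidPr sub).
have {}sub : S' :&: F \subset S :&: F by rewrite subsetI sub subsetIr.
by rewrite (setIidPl sub) subnn; apply/esym/eqP; rewrite subn_eq0 subset_leq_card.
Qed.

Lemma pdim_le_nested (c : T -> nat) w H :
    {in H, forall S, {in S, forall v, (c v < w)%N}} ->
    (forall j, nested H [set v | c v == j]) ->
    (forall i, nested H [set v | lab v == i]) ->
  pdim_le w (ideal_module (mon_span k (map label_count H))).
Proof.
elim: w H => [|w IHw] H ltc nestc nestl.
  (* With no colours every member of [H] is empty, so the ideal is zero or the whole ring. *)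
  case: H ltc {nestc nestl} => [|S H] ltc.
    apply: pdim_le_trivial => x; apply: val_inj; apply/eqP.
    have /mon_spanP := valP x; rewrite /= -msupp_eq0.
    by case: (msupp _) => // m s /(_ m (mem_head _ _)).
  apply: projective_unit_ideal.
  rewrite -mpolyX0 mem_mon_spanX /divisible_by /=.
  apply/orP; left; apply/mnm_lepP => i; rewrite mnm0E mnmE leqn0 cards_eq0.
  apply/eqP/setP => v; rewrite !inE; apply/negP => /andP[Sv _].
  by have := ltc S (mem_head _ _) v Sv.
have [m] := ubnP (size H); elim: m H ltc nestc nestl => // m IHm H ltc nestc nestl.
case: H ltc nestc nestl => [_ _ _ _|S0 H0].
  apply: pdim_le_trivial => x; apply: val_inj; apply/eqP.
  have /mon_spanP := valP x; rewrite /= -msupp_eq0.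
  by case: (msupp _) => // m' s /(_ m' (mem_head _ _)).
move: (S0 :: H0) (mem_head S0 H0) => H HS0 ltc nestc nestl ltH.
(* There are [w.+1] colours, so the last class has colour [w]. *)
have [S HS maxS] := nested_max (nestc w) HS0.
pose H' := [seq S' <- H | S' != S].
have subH' : {subset H' <= H} by move=> S'; rewrite mem_filter => /andP[].
have ltH' : (size H' < size H)%N.
  rewrite size_filter -(count_predC (pred1 S) H) addnC.
  by rewrite -[ltnLHS]addn0 ltn_add2l -has_count has_pred1.
have nestc' j := nestedS subH' (nestc j).
have nestl' i := nestedS subH' (nestl i).
(* [S] is moved to the front; all its copies in the sequence [H] have been dropped from [H']. *)
apply: (@pdim_le_ideal_eq _ _ (mon_span k (label_count S :: map label_count H'))).
  apply: eq_mon_span => h; apply: eq_has_r => g.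
  rewrite inE; apply/predU1P/mapP => [[->|/mapP[S' HS' ->]]|[S' HS' ->]].
  - by exists S.
  - by exists S' => //; apply: subH'.
  - have [->|nS] := eqVneq S' S; first by left.
    by right; apply: map_f; rewrite mem_filter nS.
apply: (@pdim_le_cons_ideal _ _ 'X_[label_count S] (mon_span k (map label_count H'))
  (mon_span k (map label_count [seq S' :\: S | S' <- H']))).
(* The colon by a monomial is computed on exponents: g' <= g + h if and only if g' - g <= h, with
   truncated subtraction. *)
- move=> q; rewrite mem_mon_spanMX unfold_in; apply: eq_all => h.
  rewrite /divisible_by -map_comp !has_map; apply: eq_in_has => S' /subH' HS' /=.
  rewrite label_countD; last first.
    by move=> i; apply: nestedS (nestl i) => A; rewrite !inE => /pred2P[]->.
  apply/mnm_lepP/mnm_lepP => le i; have := le i;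
    by rewrite mnmDE mnmBE leq_subLR.
- exact: mem_mon_span_cons.
- apply: IHw => [_ /mapP[S' /subH' HS' ->] v|j|i]; try exact: nestedD.
  (* The trace of [S'] on class [w] lies in [S], so the difference has no element of colour [w]. *)
  rewrite inE => /andP[nSv S'v].
  rewrite ltn_neqAle -ltnS (ltc S') // andbT; apply/negP => cv.
  by move/subsetP: (maxS S' HS') => /(_ v); rewrite !inE S'v cv (negPf nSv) => /(_ isT).
- apply: IHm => //; last exact: leq_trans ltH' _.
  by move=> S' /subH'/ltc.
Qed.

End Nested.

(** * Minimal generators and divisibility *)

Section MinimalGenerators.
Local Open Scope ring_scope.
Variables (k : fieldType) (n : nat) (I : ideal {mpoly k[n]}).
Hypothesis monI : monomial_ideal I.

Lemma mem_mon_span_mingens : (I : {pred _}) =i mon_span k (mingens I).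
Proof. by apply/monomials_generateE/(proj1 (mingensP monI)). Qed.

(** A generator divisible by another one could be deleted, against minimality. *)
Lemma mingens_antichain :
  {in mingens I &, forall g h, (g <= h)%MM -> g = h}.
Proof.
move=> g h Gg Gh legh; apply/eqP/negPn/negP => neqgh.
have ltH : (mingens I `\ h `<` mingens I)%fset by rewrite fproperD1.
apply: (proj2 (mingensP monI) _ ltH).
apply/(monomials_generateE _ (s := (mingens I `\ h)%fset)) => // p.
rewrite mem_mon_span_mingens; apply: eq_mon_span => m.
apply/hasP/hasP => -[u Gu leum]; last first.
  by exists u => //; move: Gu; rewrite in_fsetD1 => /andP[].
have [uh|nuh] := eqVneq u h; last by exists u => //; rewrite in_fsetD1 nuh.
exists g; first by rewrite in_fsetD1 neqgh.
by apply: lepm_trans legh _; rewrite -uh.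
Qed.

(** Some minimal generator [h] divides [g], and some [g'] in [s] divides [h]. The antichain
    condition gives [g' = g], hence [h = g]. *)
Lemma mem_mingens (s : seq 'X_{1..n}) :
    (I : {pred _}) =i mon_span k s ->
    {in s &, forall g h, (g <= h)%MM -> g = h} ->
  {subset s <= mingens I}.
Proof.
move=> Is anti g sg.
have : divisible_by (mingens I) g.
  rewrite -(mem_mon_spanX k) -mem_mon_span_mingens Is mem_mon_spanX.
  by apply/hasP; exists g => //; apply: lepm_refl.
move=> /hasP[h Gh lehg].
have : divisible_by s h.
  rewrite -(mem_mon_spanX k) -Is mem_mon_span_mingens mem_mon_spanX.
  by apply/hasP; exists h => //; apply: lepm_refl.
move=> /hasP[g' sg' leg'h].
have eqg : g' = g := anti _ _ sg' sg (lepm_trans leg'h lehg).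
rewrite eqg in leg'h.
suff -> : g = h by [].
apply/mnmP => i; apply/anti_leq.
by rewrite (mnm_lepP leg'h) (mnm_lepP lehg).
Qed.

End MinimalGenerators.

(** * Polarization and its support poset *)

Section Polarization.
Local Open Scope ring_scope.
Variables (k : fieldType) (n : nat) (I : ideal {mpoly k[n]}).
Hypothesis monI : monomial_ideal I.

Local Notation polG := (map (polarize I) (mingens I)).

Lemma leq_maxexp g i : g \in mingens I -> (g i <= maxexp I i)%N.
Proof. by move=> Gg; apply: (leq_bigmax_seq (F := fun m : 'X_{1..n} => m i)). Qed.

(** If [h i < g i], the polarized variable over [i] of 0-based position [h i] divides the
    polarization of [g] but not that of [h]. *)
Lemma polarize_reflect_lem g h : g \in mingens I ->
  (polarize I g <= polarize I h)%MM -> (g <= h)%MM.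
Proof.
move=> Gg lepol; apply/mnm_lepP => i; rewrite leqNgt; apply/negP => lthg.
have ltmax : (h i < maxexp I i)%N := leq_trans lthg (leq_maxexp i Gg).
pose v : polvar I := Tagged (fun i => 'I_(maxexp I i)) (Ordinal ltmax).
have := mnm_lepP lepol (enum_rank v).
by rewrite !mnmE /= enum_rankK /= lthg ltnn.
Qed.

Lemma polarization_mon_span :
  (polarization I : {pred _}) =i mon_span k polG.
Proof.
apply: monomial_ideal_genE => m; split=> [[g Gg ->]|/mapP[g Gg ->]].
  exact: map_f.
by exists g.
Qed.

Lemma polarization_monomial : monomial_ideal (polarization I).
Proof. by exists (fun m => exists2 g, g \in mingens I & m = polarize I g). Qed.

(** This makes every polarized generator one of the sets intersected in [suppC]. *)
Lemma polarize_mingens g : g \in mingens I ->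
  polarize I g \in mingens (polarization I).
Proof.
move=> Gg.
apply: (mem_mingens polarization_monomial polarization_mon_span); last exact: map_f.
move=> _ _ /mapP[u Gu ->] /mapP[v Gv ->] /(polarize_reflect_lem Gu) leuv.
by rewrite (mingens_antichain monI Gu Gv leuv).
Qed.

(** The support of [polarize I g], taken in [polvar I] rather than among ordinals so that [tag]
    gives the fibres. *)
Definition polset (g : 'X_{1..n}) : {set polvar I} :=
  [set v : polvar I | (tagged v < g (tag v))%N].

Lemma mem_supp_polarize g v : (enum_rank v \in supp (polarize I g)) =
  (v \in polset g).
Proof. by rewrite !inE mnmE /= enum_rankK lt0b. Qed.

Lemma label_count_polset g : g \in mingens I ->
  label_count (fun v : polvar I => tag v) (polset g) = g.
Proof.
move=> Gg; apply/mnmP => i; rewrite mnmE.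
pose t (j : 'I_(maxexp I i)) : polvar I := Tagged (fun i => 'I_(maxexp I i)) j.
have injt : injective t by move=> j j' /eqP; rewrite eq_Tagged /= => /eqP.
have -> : polset g :&: [set v : polvar I | tag v == i] =
    t @: [set j : 'I_(maxexp I i) | (j < g i)%N].
  apply/setP => v; rewrite !inE; apply/andP/imsetP => [|[j + ->]].
    by case: v => i' j [ltj /eqP/= eqi]; subst i'; exists j; rewrite ?inE.
  by rewrite inE.
rewrite card_imset //.
have -> : [set j : 'I_(maxexp I i) | (j < g i)%N] =
  [set widen_ord (leq_maxexp i Gg) j | j : 'I_(g i)].
  apply/setP => j; rewrite inE; apply/idP/imsetP => [ltj|[j' _ ->]] //=.
  by exists (Ordinal ltj) => //; apply: val_inj.
by rewrite card_imset ?card_ord // => j j' /(congr1 val)/= /val_inj.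
Qed.

(** Over one variable these sets are initial segments, hence comparable. *)
Lemma polset_nested_fibre i :
  nested (map polset (mingens I)) [set v : polvar I | tag v == i].
Proof.
move=> _ _ /mapP[g _ ->] /mapP[h _ ->].
have sub (g' h' : 'X_{1..n}) : (g' i <= h' i)%N ->
    polset g' :&: [set v : polvar I | tag v == i] \subset polset h'.
  move=> le; apply/subsetP => v; rewrite !inE => /andP[lt /eqP tv].
  by apply: leq_trans lt _; rewrite tv.
by have /orP[/sub->//|/sub->] := leq_total (g i) (h i); rewrite ?orbT.
Qed.

Local Notation suppC_var v := (suppC (polarization I) (enum_rank v)).

Lemma suppC_suppPos g v : g \in mingens I -> v \in polset g ->
  suppC_var v \in suppPos (polarization I).
Proof.
move=> Gg gv; apply: imset_f.
by rewrite /supp_ideal (big_rem _ (polarize_mingens Gg)) inE mem_supp_polarize gv.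
Qed.

Lemma suppC_self v : enum_rank v \in suppC_var v.
Proof. by rewrite /suppC; elim/big_rec: _ => [|m A vm vA]; rewrite inE ?vm. Qed.

(** [v] lies in its own [suppC], hence in that of [w], which is contained in the support of every
    minimal generator divisible by [w]. *)
Lemma polset_suppC g v w : g \in mingens I ->
  suppC_var v \subset suppC_var w -> w \in polset g -> v \in polset g.
Proof.
move=> Gg /subsetP/(_ _ (suppC_self v)) vw gw.
move: vw; rewrite /suppC (big_rem _ (polarize_mingens Gg)) /=.
by rewrite mem_supp_polarize gw inE mem_supp_polarize => /andP[].
Qed.

Lemma pdim_le_width :
  pdim_le (width inclusion (suppPos (polarization I))) (ideal_module I).
Proof.
have incl_refl : reflexive (@inclusion 'I_#|polvar I|) by move=> A; apply: subxx.
have incl_anti : antisymmetric (@inclusion 'I_#|polvar I|).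
  by move=> A B; rewrite /inclusion -eqEsubset => /eqP.
have incl_trans : transitive (@inclusion 'I_#|polvar I|).
  by move=> B A C; apply: subset_trans.
have [c ltc chc] :=
  dilworth incl_refl incl_anti incl_trans (suppPos (polarization I)).
have eqI : mon_span k (map (label_count (fun v : polvar I => tag v))
    (map polset (mingens I))) =i I.
  have -> : map (label_count (fun v : polvar I => tag v)) (map polset (mingens I))
      = mingens I.
    by rewrite -map_comp -[RHS]map_id; apply/eq_in_map => g /label_count_polset.
  by move=> p; rewrite (mem_mon_span_mingens monI).
apply: pdim_le_ideal_eq eqI _.
(* A variable inherits the colour of its [suppC] in a chain cover of the support poset. *)
apply: (pdim_le_nested _ (c := fun v => c (suppC_var v))) => [|j|i].
- move=> _ /mapP[g Gg ->] v gv; apply: ltc; exact: suppC_suppPos gv.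
- move=> _ _ /mapP[g Gg ->] /mapP[h Gh ->].
  (* If neither inclusion holds, there are [v] in [g] only and [w] in [h] only, of equal colour.
     Their [suppC] are comparable, which forces [v] into [h] or [w] into [g]. *)
  rewrite -[_ || _]negbK negb_or; apply/negP.
  move=> /andP[/subsetPn[v + nhv] /subsetPn[w + ngw]].
  rewrite !in_setI => /andP[gv] /[1!inE] /eqP cv /andP[hw] /[1!inE] /eqP cw.
  have := chc _ _ (suppC_suppPos Gg gv) (suppC_suppPos Gh hw).
  rewrite cv cw => /(_ erefl)/orP[le|le].
    by rewrite (polset_suppC Gh le hw) in nhv.
  by rewrite (polset_suppC Gg le gv) in ngw.
- exact: polset_nested_fibre.
Qed.

End Polarization.

Theorem theorem3p12 (k : fieldType) (n : nat) (I : ideal {mpoly k[n]})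
    (monI : monomial_ideal I) (fullI : full_support I) :
  exists d : nat, is_projdim (ideal_module I) d /\
    d <= width inclusion (suppPos (polarization I)).
Proof.
by have [d projd led] := pdim_le_is_projdim (pdim_le_width monI); exists d.
Qed.
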